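(* Let $n\ge1$ and $\mathbf{P}_A,\mathbf{P}_B,\mathbf{Q}_A,\mathbf{Q}_B\in\mathbb{R}^{n\times n}$ be symmetric positive definite. Let $\mathbf{x}\in\mathbb{R}^n$, $\mathbf{x}\neq\mathbf{0}$. The following three cases are mutually exclusive and collectively exhaustive: (1) $\mathbf{x}^\intercal\mathbf{H}_{\mathrm{SCI}}'(0)\mathbf{x}<0$; in this case $g(\mathbf{x})=\mathbf{x}^\intercal\mathbf{H}_{\mathrm{SCI}}(0)\mathbf{x}$. (2) $\mathbf{x}^\intercal\mathbf{H}_{\mathrm{SCI}}'(1)\mathbf{x}>0$; in this case $g(\mathbf{x})=\mathbf{x}^\intercal\mathbf{H}_{\mathrm{SCI}}(1)\mathbf{x}$. (3) There exists a unique $\omega_0\in[0,1]$ such that $\mathbf{x}^\intercal\mathbf{H}_{\mathrm{SCI}}'(\omega_0)\mathbf{x}=0$; in this case $g(\mathbf{x})=\mathbf{x}^\intercal\mathbf{H}_{\mathrm{SCI}}(\omega_0)\mathbf{x}$.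
   Context: $\mathbf{C}_A=\mathbf{P}_A+\mathbf{Q}_A$, $\mathbf{C}_B=\mathbf{P}_B+\mathbf{Q}_B$. For $\omega\in[0,1]$, $\bar\omega=1-\omega$, let $\mathbf{H}_{\mathrm{SCI}}(\omega)=\omega(\mathbf{P}_A+\omega\mathbf{Q}_A)^{-1}+\bar\omega(\mathbf{P}_B+\bar\omega\mathbf{Q}_B)^{-1}$ and $\mathbf{H}_{\mathrm{SCI}}'$ its derivative with respect to $\omega$. $\mathcal{A}_{\mathrm{Split}}=\{\mathbf{M}\in\mathbb{R}^{n\times n} : \begin{bmatrix}\mathbf{P}_A & \mathbf{M}\\ \mathbf{M}^\intercal & \mathbf{P}_B\end{bmatrix}\succeq 0\}$. For $\mathbf{K}=(\mathbf{K}_A,\mathbf{K}_B)$, $\mathbf{C}_F(\mathbf{K},\mathbf{P}_{AB})=\mathbf{K}_A\mathbf{C}_A\mathbf{K}_A^\intercal+\mathbf{K}_A\mathbf{P}_{AB}\mathbf{K}_B^\intercal+\mathbf{K}_B\mathbf{P}_{AB}^\intercal\mathbf{K}_A^\intercal+\mathbf{K}_B\mathbf{C}_B\mathbf{K}_B^\intercal$. For $\mathbf{P}_{AB}\in\mathcal{A}_{\mathrm{Split}}$ let $\mathbf{R}=\mathbf{C}_A+\mathbf{C}_B-\mathbf{P}_{AB}-\mathbf{P}_{AB}^\intercal$, $\mathbf{K}_A^*=(\mathbf{C}_B-\mathbf{P}_{AB}^\intercal)\mathbf{R}^{-1}$, $\mathbf{C}_F^*(\mathbf{P}_{AB})=\mathbf{C}_F((\mathbf{K}_A^*,\mathbf{I}-\mathbf{K}_A^*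 ),\mathbf{P}_{AB})$ and $\mathbf{M}_F^*(\mathbf{P}_{AB})=\mathbf{C}_F^*(\mathbf{P}_{AB})^{-1}$. Define $g(\mathbf{x})=\min_{\mathbf{P}_{AB}\in\mathcal{A}_{\mathrm{Split}}}\mathbf{x}^\intercal\mathbf{M}_F^*(\mathbf{P}_{AB})\mathbf{x}$. *)

(* Defs.v *)
From HB Require Import structures.
From mathcomp Require Import all_boot all_order all_algebra.
From mathcomp Require Import all_classical all_reals all_analysis.
Set Implicit Arguments. Unset Strict Implicit. Unset Printing Implicit Defensive.
Import Order.TTheory GRing.Theory Num.Theory.
Import numFieldNormedType.Exports.
Local Open Scope ring_scope.

Section Defs.
Variables (R : realType) (n : nat).

Definition qf (M : 'M[R]_n) (x : 'cV[R]_n) : R := (x^T *m M *m x) 0 0.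

Definition spd (M : 'M[R]_n) : Prop :=
  M^T = M /\ forall y : 'cV[R]_n, y != 0 -> 0 < qf M y.

Definition H_SCI (PA PB QA QB : 'M[R]_n) (w : R) : 'M[R]_n :=
  w *: invmx (PA + w *: QA) + (1 - w) *: invmx (PB + (1 - w) *: QB).

Definition A_split (PA PB : 'M[R]_n) (M : 'M[R]_n) : Prop :=
  forall z : 'cV[R]_(n + n), 0 <= (z^T *m block_mx PA M M^T PB *m z) 0 0.

Definition C_F (CA CB KA KB PAB : 'M[R]_n) : 'M[R]_n :=
  KA *m CA *m KA^T + KA *m PAB *m KB^T + KB *m PAB^T *m KA^T + KB *m CB *m KB^T.

Definition C_F_star (PA PB QA QB PAB : 'M[R]_n) : 'M[R]_n :=
  let CA := PA + QA in
  let CB := PB + QB in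
  let Rm := CA + CB - PAB - PAB^T in
  let KA := (CB - PAB^T) *m invmx Rm in
  C_F CA CB KA (1%:M - KA) PAB.

Definition M_F_star (PA PB QA QB PAB : 'M[R]_n) : 'M[R]_n :=
  invmx (C_F_star PA PB QA QB PAB).

Definition is_g_value (PA PB QA QB : 'M[R]_n) (x : 'cV[R]_n) (v : R) : Prop :=
  (exists PAB, A_split PA PB PAB /\ qf (M_F_star PA PB QA QB PAB) x = v) /\
  (forall PAB, A_split PA PB PAB -> v <= qf (M_F_star PA PB QA QB PAB) x).

End Defs.

(* Main.v *)
(* Put u = (PA + w QA)^-1 x and v = (PB + (1-w) QB)^-1 x. The derivative of
   w |-> x^T H(w) x is u^T PA u - v^T PB v, which is strictly decreasing; this
   gives the trichotomy. With Sigma the joint covariance and E = (I, I), one has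
   x^T M_F* x = max_z (2 z^T E x - z^T Sigma z), and z = (w u, (1-w) v) together
   with 2 u^T PAB v <= u^T PA u + v^T PB v yields x^T H(w) x <= x^T M_F* x for
   every admissible PAB and every w. Equality holds at the critical w for
   PAB = c^-1 (PA u) (PB v)^T, c = max (u^T PA u, v^T PB v): it is admissible by
   Cauchy-Schwarz and makes Sigma z = E x. *)
Require Import Defs.
From HB Require Import structures.
From mathcomp Require Import all_boot all_order all_algebra.
From mathcomp Require Import all_classical all_reals all_analysis.
From mathcomp Require Import ring lra.
Import Order.TTheory GRing.Theory Num.Theory.
Import numFieldNormedType.Exports.
Local Open Scope ring_scope.
Set Implicit Arguments.
Unset Strict Implicit.
Unset Printing Implicit Defensive.

(** * Symmetric positive definite forms *)

Section QuadraticForms.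
Context {R : realType} {n : nat}.
Implicit Types (M P Q : 'M[R]_n) (a b p q x y : 'cV[R]_n).

Definition dot a b : R := (a^T *m b) 0 0.

Lemma dotDl a b y : dot (a + b) y = dot a y + dot b y.
Proof. by rewrite /dot linearD mulmxDl mxE. Qed.

Lemma dotDr a b y : dot y (a + b) = dot y a + dot y b.
Proof. by rewrite /dot mulmxDr mxE. Qed.

Lemma dotZl k a b : dot (k *: a) b = k * dot a b.
Proof. by rewrite /dot linearZ /= -scalemxAl mxE. Qed.

Lemma dotZr k a b : dot a (k *: b) = k * dot a b.
Proof. by rewrite /dot -scalemxAr mxE. Qed.

Lemma dotNl a b : dot (- a) b = - dot a b.
Proof. by rewrite -scaleN1r dotZl mulN1r. Qed.

Lemma dotNr a b : dot a (- b) = - dot a b.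
Proof. by rewrite -scaleN1r dotZr mulN1r. Qed.

Lemma dot0r a : dot a 0 = 0.
Proof. by rewrite /dot mulmx0 mxE. Qed.

Definition dotE := (dotDl, dotDr, dotZl, dotZr, dotNl, dotNr).

Lemma dotC a b : dot a b = dot b a.
Proof. by rewrite /dot -[a^T *m b]trmxK trmx_mul trmxK mxE. Qed.

Lemma dot_mulmx M a b : dot (M *m a) b = dot a (M^T *m b).
Proof. by rewrite /dot trmx_mul mulmxA. Qed.

Lemma dot_mulmxC M a b : dot a (M *m b) = dot b (M^T *m a).
Proof. by rewrite dotC dot_mulmx. Qed.

Lemma dot_rank1 p q a b : dot a (p *m q^T *m b) = dot a p * dot q b.
Proof. by rewrite /dot -mulmxA mulmxA [LHS]mxE big_ord1. Qed.

Lemma qfE M x : qf M x = dot x (M *m x).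
Proof. by rewrite /qf /dot mulmxA. Qed.

Lemma spd_sym P : spd P -> P^T = P.
Proof. by case. Qed.

Lemma spd_gt0 P a : spd P -> a != 0 -> 0 < dot a (P *m a).
Proof. by move=> [_ hP] /hP; rewrite qfE. Qed.

Lemma spd_ge0 P a : spd P -> 0 <= dot a (P *m a).
Proof.
move=> hP; have [->|/(spd_gt0 hP)/ltW //] := eqVneq a 0.
by rewrite mulmx0 dot0r.
Qed.

Lemma spd_eq0 P a : spd P -> dot a (P *m a) <= 0 -> a = 0.
Proof.
by move=> hP; apply: contraTeq => /(spd_gt0 hP); rewrite ltNge.
Qed.

Lemma spd_dotC P a b : spd P -> dot a (P *m b) = dot b (P *m a).
Proof. by move=> hP; rewrite dot_mulmxC (spd_sym hP). Qed.

Lemma inj_unitmx M : (forall y, M *m y = 0 -> y = 0) -> M \in unitmx.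
Proof.
move=> Minj; rewrite -unitmx_tr -row_free_unit -kermx_eq0.
apply/eqP/row_matrixP => i; rewrite row0.
apply: trmx_inj; rewrite trmx0; apply: Minj.
apply: trmx_inj; rewrite trmx_mul trmxK trmx0.
by apply/sub_kermxP; rewrite row_sub.
Qed.

Lemma spd_unitmx P : spd P -> P \in unitmx.
Proof.
by move=> hP; apply: inj_unitmx => y Py0; apply: (spd_eq0 hP);
  rewrite Py0 dot0r.
Qed.

Lemma spdDZ P Q w : spd P -> spd Q -> 0 <= w -> spd (P + w *: Q).
Proof.
move=> hP hQ w0; split; first by rewrite linearD linearZ /= !spd_sym.
move=> y y0; rewrite qfE mulmxDl -scalemxAl !dotE.
by rewrite ltr_pwDl ?spd_gt0 // mulr_ge0 ?spd_ge0.
Qed.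

Lemma spd_solve P x : spd P -> P *m (invmx P *m x) = x.
Proof. by move=> hP; rewrite mulmxA mulmxV ?spd_unitmx // mul1mx. Qed.

Lemma spd_cauchy_schwarz P a b : spd P ->
  dot a (P *m b) ^+ 2 <= dot a (P *m a) * dot b (P *m b).
Proof.
move=> hP; have [->|b0] := eqVneq b 0.
  by rewrite mulmx0 !dot0r expr0n mulr0.
have pb := spd_gt0 hP b0.
(* Up to the factor [dot b (P *m b)], this vector is the component of [a] that is [P]-orthogonal to
   [b]. Scaling it this way avoids a division. *)
have := spd_ge0 (dot b (P *m b) *: a - dot a (P *m b) *: b) hP.
rewrite mulmxBr -!scalemxAr !dotE (spd_dotC b a hP).
set p := dot b _ in pb *; set q := dot a _; set r := dot a _ => h.
by rewrite -(ler_pM2l pb); lra.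
Qed.

End QuadraticForms.

(** * Admissible cross-covariances and optimal fusion *)

Section Split.
Context {R : realType} {n : nat}.
Implicit Types (M PA PB QA QB : 'M[R]_n) (a b x y : 'cV[R]_n).

Lemma A_splitP PA PB M : A_split PA PB M <->
  forall a b, 0 <= dot a (PA *m a) + 2 * dot a (M *m b) + dot b (PB *m b).
Proof.
have E a b : ((col_mx a b)^T *m block_mx PA M M^T PB *m col_mx a b) 0 0 =
    dot a (PA *m a) + 2 * dot a (M *m b) + dot b (PB *m b).
  rewrite -mulmxA mul_block_col tr_col_mx mul_row_col mxE -!/(dot _ _) !dotE.
  by rewrite (dot_mulmxC _ b a) trmxK; ring.
split=> [h a b|h z]; first by rewrite -E.
by rewrite -(vsubmxK z) E.
Qed.

(* The optimal gains satisfy [K Sigma = [N, N]] for the joint covariance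
   [Sigma], where [N] is the fused covariance; hence [z = K^T N^-1 x] solves
   [Sigma z = (x, x)], i.e. [M_F_star = E^T Sigma^-1 E] with [E = (I, I)]. *)
Lemma M_F_star_rep PA PB QA QB M x :
  spd PA -> spd PB -> spd QA -> spd QB -> A_split PA PB M ->
  exists z1 z2, [/\ (PA + QA) *m z1 + M *m z2 = x,
    M^T *m z1 + (PB + QB) *m z2 = x &
    qf (M_F_star PA PB QA QB M) x = dot x (z1 + z2)].
Proof.
move=> hPA hPB hQA hQB /A_splitP hM; rewrite /M_F_star /C_F_star /=.
set CA := PA + QA; set CB := PB + QB.
have sA : CA^T = CA by rewrite linearD /= !spd_sym.
have sB : CB^T = CB by rewrite linearD /= !spd_sym.
(* [S] is the quadratic form of the joint covariance. Admissibility makes its [PA], [PB], [M] part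
   nonnegative, so it dominates the [QA], [QB] part and is definite. *)
pose S a b := dot a (CA *m a + M *m b) + dot b (M^T *m a + CB *m b).
have Sge a b : dot a (QA *m a) + dot b (QB *m b) <= S a b.
  rewrite /S !mulmxDl !dotE (dot_mulmxC _ b a) trmxK.
  by have := hM a b; lra.
clearbody CA CB; have S0 a b : S a b = 0 -> a = 0 /\ b = 0.
  move=> Sab; have := Sge a b; rewrite Sab.
  have := spd_ge0 a hQA; have := spd_ge0 b hQB => b0 a0 ab0.
  by split; [apply: (spd_eq0 hQA)|apply: (spd_eq0 hQB)]; lra.
set X := CB - M^T; set Y := CA - M.
have -> : CA + CB - M - M^T = X + Y.
  by rewrite -addrA -opprD [M + _]addrC opprD [CA + _]addrC addrACA.
have uR : X + Y \in unitmx.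
  apply: inj_unitmx => y Ry0.
  (* The form of [X + Y] at [y] is the joint form at [(y, -y)]. *)
  suff /S0[] : S y (- y) = 0 by [].
  have : dot y ((X + Y) *m y) = 0 by rewrite Ry0 dot0r.
  rewrite /S /X /Y !mulmxDl !mulNmx !mulmxN !dotE; lra.
set KA := X *m _; set KB := 1%:M - KA.
have KBE : KB = Y *m invmx (X + Y).
  by rewrite /KB -(mulmxV uR) mulmxDl addrAC subrr add0r.
(* This is the symmetry of the parallel sum, [X (X+Y)^-1 Y = Y (X+Y)^-1 X]. It makes the two blocks
   of [K Sigma] equal. *)
have KXY : KA *m Y = KB *m X.
  have -> : KA *m Y = X - KA *m X.
    rewrite -{1}[X]mulmx1 -(mulVmx uR) mulmxA -/KA -mulmxBr.
    by rewrite addrAC subrr add0r.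
  by rewrite /KB mulmxBl mul1mx.
have Ksum : KA + KB = 1%:M by rewrite /KB addrC subrK.
clearbody KB; clear KBE; set N := KA *m CA + KB *m M^T.
have NE : N = KA *m M + KB *m CB.
  apply/eqP; rewrite -subr_eq0 /N opprD addrACA -mulmxBr -/Y KXY -mulmxBr.
  by rewrite -mulmxDr /X addrC subrKA subrr mulmx0.
(* [K Sigma K^T = N (KA + KB)^T], and the gains sum to the identity. *)
have CFE : C_F CA CB KA KB M = N.
  rewrite -[RHS]mulmx1 -(trmx1 R n) -Ksum linearD mulmxDr [X in _ + X *m _]NE.
  by rewrite /C_F /N !mulmxDl -!addrA; congr (_ + _); rewrite addrCA.
have NT : N^T = N.
  rewrite -CFE /C_F !linearD /= !trmx_mul !trmxK sA sB !mulmxA.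
  by rewrite [X in X + _ = _]addrAC.
have z1E y : CA *m (KA^T *m y) + M *m (KB^T *m y) = N *m y.
  by rewrite -[in RHS]NT /N linearD /= !trmx_mul trmxK sA mulmxDl !mulmxA.
have z2E y : M^T *m (KA^T *m y) + CB *m (KB^T *m y) = N *m y.
  by rewrite -[in RHS]NT NE linearD /= !trmx_mul sB mulmxDl !mulmxA.
have zsum y : KA^T *m y + KB^T *m y = y.
  by rewrite -mulmxDl -linearD /= Ksum trmx1 mul1mx.
(* If [N y = 0], the joint form vanishes at [K^T y], whose two halves sum to [y]. *)
have uN : N \in unitmx.
  apply: inj_unitmx => y Ny0.
  have /S0[a0 b0] : S (KA^T *m y) (KB^T *m y) = 0.
    by rewrite /S z1E z2E Ny0 !dot0r addr0.
  by rewrite -(zsum y) a0 b0 addr0.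
rewrite CFE; exists (KA^T *m (invmx N *m x)), (KB^T *m (invmx N *m x)).
by rewrite z1E z2E zsum qfE mulmxA mulmxV // mul1mx.
Qed.

Lemma qf_H_SCI PA PB QA QB w x : qf (H_SCI PA PB QA QB w) x =
  w * dot x (invmx (PA + w *: QA) *m x) +
  (1 - w) * dot x (invmx (PB + (1 - w) *: QB) *m x).
Proof. by rewrite qfE mulmxDl -!scalemxAl !dotE. Qed.

Lemma H_SCI_le PA PB QA QB M w x :
  spd PA -> spd PB -> spd QA -> spd QB -> A_split PA PB M -> 0 <= w <= 1 ->
  qf (H_SCI PA PB QA QB w) x <= qf (M_F_star PA PB QA QB M) x.
Proof.
move=> hPA hPB hQA hQB hM /andP[w0 w1].
have [z1 [z2 [e1 e2 ->]]] := M_F_star_rep x hPA hPB hQA hQB hM.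
move/A_splitP in hM; rewrite qf_H_SCI.
have w1' : 0 <= 1 - w by lra.
have /(spd_solve x) := spdDZ hPA hQA w0.
have /(spd_solve x) := spdDZ hPB hQB w1'.
set u := invmx (PA + _) *m x; set v := invmx (PB + _) *m x; clearbody u v.
rewrite !mulmxDl -!scalemxAl in e1 e2 * => ev eu.
have E1 y : dot y x = dot y (PA *m z1) + dot y (QA *m z1) + dot y (M *m z2).
  by rewrite -{1}e1 !dotE.
have E2 y : dot y x = dot z1 (M *m y) + (dot y (PB *m z2) + dot y (QB *m z2)).
  by rewrite -{1}e2 !dotE (dot_mulmxC M^T) trmxK.
have Eu y : dot y x = dot y (PA *m u) + w * dot y (QA *m u).
  by rewrite -{1}eu !dotE.
have Ev y : dot y x = dot y (PB *m v) + (1 - w) * dot y (QB *m v).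
  by rewrite -{1}ev !dotE.
(* Together with the two [Q] terms below, this says that the joint form is nonnegative at the
   difference between [(z1, z2)] and the trial vector [(w u, (1-w) v)]. *)
have := hM (z1 - w *: u) (z2 - (1 - w) *: v).
have := hM u (- v).
have := spd_ge0 (z1 - w *: u) hQA; have := spd_ge0 (z2 - (1 - w) *: v) hQB.
rewrite !mulmxBr !mulmxN -!scalemxAr !dotE.
rewrite (spd_dotC z1 u hPA) (spd_dotC z1 u hQA).
rewrite (spd_dotC z2 v hPB) (spd_dotC z2 v hQB).
have := E1 z1; have := E1 u; have := E2 z2; have := E2 v.
have := Eu u; have := Ev v.
rewrite !(dotC x).
set xu := dot u x; set xv := dot v x.
move=> Hv Hu H2v H2 H1u H1 QB0 QA0 P0 P1.
(* The cross term of the trial vector carries the weight [2 w (1-w)]. Bounding it by [P0] turns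
   [w^2 + w (1-w)] into [w], and likewise for [1-w], so the joint form of the trial vector is at
   most [w u^T x + (1-w) v^T x]. *)
have := mulr_ge0 (mulr_ge0 w0 w1') P0.
have := congr1 ( *%R w) Hu; have := congr1 ( *%R (1 - w)) Hv.
have := congr1 ( *%R w) H1u; have := congr1 ( *%R (1 - w)) H2v.
by lra.
Qed.

(** Put [alpha = a^T PA u] and [beta = b^T PB v]. By Cauchy-Schwarz [alpha^2 <= c a^T PA a] and
    [beta^2 <= c b^T PB b], so [c] times the block form at [(a, b)] is at least
    [(alpha + beta)^2]. *)
Lemma A_split_rank1 PA PB u v c : spd PA -> spd PB -> 0 < c ->
  dot u (PA *m u) <= c -> dot v (PB *m v) <= c ->
  A_split PA PB (c^-1 *: (PA *m u *m (PB *m v)^T)).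
Proof.
move=> hPA hPB c0 uc vc; apply/A_splitP => a b.
have -> : dot a ((c^-1 *: (PA *m u *m (PB *m v)^T)) *m b) =
    c^-1 * dot a (PA *m u) * dot b (PB *m v).
  by rewrite -scalemxAl dotZr dot_rank1 (dotC b) mulrA.
have A0 := spd_ge0 a hPA; have B0 := spd_ge0 b hPB.
have hA : dot a (PA *m u) ^+ 2 <= dot a (PA *m a) * c.
  by apply: le_trans (spd_cauchy_schwarz a u hPA) _; rewrite ler_wpM2l.
have hB : dot b (PB *m v) ^+ 2 <= dot b (PB *m b) * c.
  by apply: le_trans (spd_cauchy_schwarz b v hPB) _; rewrite ler_wpM2l.
rewrite -(pmulr_rge0 _ c0) 2!mulrDr mulrCA.
rewrite -[c^-1 * _ * _]mulrA mulVKf ?gt_eqF //.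
have := sqr_ge0 (dot a (PA *m u) + dot b (PB *m v)); lra.
Qed.

(** The last two hypotheses are complementary slackness: a bound by [c] must be tight wherever its
    weight is nonzero. This treats both endpoints and an interior critical point at once. *)
Lemma is_g_value_H_SCI PA PB QA QB w x c :
  let u := invmx (PA + w *: QA) *m x in
  let v := invmx (PB + (1 - w) *: QB) *m x in
  spd PA -> spd PB -> spd QA -> spd QB -> 0 <= w <= 1 -> 0 < c ->
  dot u (PA *m u) <= c -> dot v (PB *m v) <= c ->
  w * (dot u (PA *m u) - c) = 0 -> (1 - w) * (dot v (PB *m v) - c) = 0 ->
  is_g_value PA PB QA QB x (qf (H_SCI PA PB QA QB w) x).
Proof.
move=> u v hPA hPB hQA hQB hw c0 uc vc cu cv; split; last first.
  by move=> M hM; exact: H_SCI_le.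
have hM := A_split_rank1 hPA hPB c0 uc vc.
set M := _ *: _ in hM; exists M; split=> //.
have [z1 [z2 [e1 e2 ->]]] := M_F_star_rep x hPA hPB hQA hQB hM.
rewrite qf_H_SCI -/u -/v; case/andP: hw => w0 w1.
have w1' : 0 <= 1 - w by lra.
have eu : PA *m u + w *: (QA *m u) = x.
  by rewrite scalemxAl -mulmxDl; apply/spd_solve/spdDZ.
have ev : PB *m v + (1 - w) *: (QB *m v) = x.
  by rewrite scalemxAl -mulmxDl; apply/spd_solve/spdDZ.
have cn : c^-1 * c = 1 by rewrite mulVf ?gt_eqF.
(* Where [1 - w] is nonzero, slackness gives [M v = PA u]; keeping the weight avoids a case split.
   [Mu] is the mirror image. Together they give [Sigma (w u, (1-w) v) = (x, x)]. *)
have Mv y : (1 - w) * dot y (M *m v) = (1 - w) * dot y (PA *m u).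
  rewrite /M -scalemxAl dotZr dot_rank1 (dotC (PB *m v)).
  suff -> : (1 - w) * (c^-1 * (dot y (PA *m u) * dot v (PB *m v))) =
     (1 - w) * dot y (PA *m u) * (c^-1 * c) +
     c^-1 * dot y (PA *m u) * ((1 - w) * (dot v (PB *m v) - c)).
    by rewrite cv cn mulr1 mulr0 addr0.
  by ring.
have Mu y : w * dot u (M *m y) = w * dot y (PB *m v).
  rewrite /M -scalemxAl dotZr dot_rank1 (dotC (PB *m v)).
  suff -> : w * (c^-1 * (dot u (PA *m u) * dot y (PB *m v))) =
     w * dot y (PB *m v) * (c^-1 * c) +
     c^-1 * dot y (PB *m v) * (w * (dot u (PA *m u) - c)).
    by rewrite cu cn mulr1 mulr0 addr0.
  by ring.
(* Both sides are the bilinear form of [Sigma] between [(z1, z2)] and [(w u, (1-w) v)], since each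
   of these vectors is sent to [(x, x)]. *)
clearbody M; rewrite dotC dotDl (dotC x u) (dotC x v).
rewrite !mulmxDl in e1 e2.
have -> : dot u x = dot u (PA *m z1) + dot u (QA *m z1) + dot u (M *m z2).
  by rewrite -{1}e1 !dotE.
have -> : dot v x = dot z1 (M *m v) + (dot v (PB *m z2) + dot v (QB *m z2)).
  by rewrite -{1}e2 !dotE (dot_mulmxC M^T) trmxK.
have -> : dot z1 x = dot z1 (PA *m u) + w * dot z1 (QA *m u).
  by rewrite -{1}eu !dotE.
have -> : dot z2 x = dot z2 (PB *m v) + (1 - w) * dot z2 (QB *m v).
  by rewrite -{1}ev !dotE.
rewrite (spd_dotC z1 u hPA) (spd_dotC z1 u hQA) (spd_dotC z2 v hPB).
rewrite (spd_dotC z2 v hQB).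
have := Mv z1; have := Mu z2; rewrite (spd_dotC z1 u hPA) (spd_dotC z2 v hPB).
lra.
Qed.

End Split.

(** * Strict decrease of the rate *)

Section InverseRate.
Context {R : realType} {n : nat}.
Implicit Types (P Q : 'M[R]_n) (x : 'cV[R]_n) (s t w : R).

(* [inv_rate P Q x w] is the derivative at [w] of
   [w x^T (P + w Q)^-1 x]. *)
Definition inv_rate P Q x w : R :=
  dot (invmx (P + w *: Q) *m x) (P *m (invmx (P + w *: Q) *m x)).

Lemma inv_rate_gt0 P Q x w :
  spd P -> spd Q -> x != 0 -> 0 <= w -> 0 < inv_rate P Q x w.
Proof.
move=> hP hQ x0 w0; apply: spd_gt0 => //; apply: contra_neq x0 => u0.
by rewrite -(spd_solve x (spdDZ hP hQ w0)) u0 mulmx0.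
Qed.

(** Let [d = us - ut]. The rate drops by [d^T P d + 2 ut^T P d]. Subtracting the two linear systems
    gives [P d = Q q] with [q = (t-s) ut - s d], and [q^T Q q >= 0] reads
    [(t-s) ut^T P d >= s d^T P d], so the cross term is nonnegative. *)
Lemma inv_rate_lt P Q x s t : spd P -> spd Q -> x != 0 -> 0 <= s -> s < t ->
  inv_rate P Q x t < inv_rate P Q x s.
Proof.
move=> hP hQ x0 s0 st; rewrite /inv_rate.
pose u r := invmx (P + r *: Q) *m x; rewrite -!/(u _).
have t0 : 0 <= t by lra.
have eu r : 0 <= r -> P *m u r + r *: (Q *m u r) = x.
  by move=> r0; rewrite scalemxAl -mulmxDl; apply/spd_solve/spdDZ.
have := eu s s0; rewrite -(eu t t0); have := eu t t0.
move: (u s) (u t) => us ut et es.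
have [d Ed] : exists d, us = d + ut by exists (us - ut); rewrite subrK.
rewrite Ed in es *.
rewrite !mulmxDr in es.
have dP y : dot y (P *m d) = dot y (Q *m ((t - s) *: ut - s *: d)).
  have := congr1 (dot y) es.
  by rewrite mulmxBr -!scalemxAr !dotE; lra.
(* If [d = 0], then [Q] vanishes at [ut], hence [ut = 0] and [x = 0]. *)
have d0 : d != 0.
  apply: contra_neq x0 => d0; rewrite -et.
  suff -> : ut = 0 by rewrite !mulmx0 scaler0 addr0.
  apply: (spd_eq0 hQ); have := dP ut.
  rewrite d0 scaler0 subr0 mulmx0 dot0r -scalemxAr dotZr => /esym/eqP.
  by rewrite mulf_eq0 subr_eq0 gt_eqF //= => /eqP ->.
have pd := spd_gt0 hP d0; rewrite mulmxDr !dotE (spd_dotC d ut hP).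
have : 0 <= (t - s) * dot ut (P *m d).
  have := spd_ge0 ((t - s) *: ut - s *: d) hQ; rewrite -dP !dotE.
  by have := mulr_ge0 s0 (ltW pd); lra.
by rewrite pmulr_rge0 ?subr_gt0 //; lra.
Qed.

(** [G - w G Q G = G P G], from [G = G (P + w Q) G]. The left side is what the product rule yields
    for [w G]. *)
Lemma inv_rateE P Q x w : spd P -> spd Q -> 0 <= w ->
  let G := invmx (P + w *: Q) in
  dot x ((G - w *: (G *m Q *m G)) *m x) = inv_rate P Q x w.
Proof.
move=> hP hQ w0 G; have hG := spdDZ hP hQ w0.
have GT : G^T = G by rewrite trmx_inv spd_sym.
rewrite /inv_rate -/G; suff -> : G - w *: (G *m Q *m G) = G *m P *m G.
  by rewrite dot_mulmx GT !mulmxA.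
rewrite -{1}(mulmx1 G) -{1}(mulmxV (spd_unitmx hG)) -/G.
by rewrite mulmxDl mulmxDr -scalemxAl -scalemxAr !mulmxA addrK.
Qed.

End InverseRate.

(** * Differentiating the inverse of an affine pencil *)

Section InverseDerivative.
Local Open Scope classical_set_scope.
Context {R : realType}.

Lemma derivable_trmx {m n : nat} (F : R -> 'M[R]_(m, n)) w :
  derivable F w 1 -> derivable (fun t => (F t)^T) w 1.
Proof.
move=> /derivable_mxP hF; apply/derivable_mxP => i j.
have -> : (fun t => (F t)^T i j) = (fun t => F t j i).
  by apply/funext => t; rewrite mxE.
exact: hF.
Qed.

Lemma derivable_mulmx {m n p : nat} (F : R -> 'M[R]_(m, n))
    (K : R -> 'M[R]_(n, p)) w :
  derivable F w 1 -> derivable K w 1 -> derivable (fun t => F t *m K t) w 1.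
Proof.
move=> /derivable_mxP hF /derivable_mxP hK; apply/derivable_mxP => i j.
have -> : (fun t => (F t *m K t) i j) =
    \sum_(k < n) ((fun t => F t i k) * (fun t => K t k j)).
  by apply/funext => t; rewrite mxE fct_sumE.
by apply: derivable_sum => k; exact: derivableM.
Qed.

Context {n : nat}.

Lemma is_derive_scale_mx (f : R -> R) (F : R -> 'M[R]_n)
    (w df : R) (dF : 'M[R]_n) :
  is_derive w 1 f df -> is_derive w 1 F dF ->
  is_derive w 1 (fun t => f t *: F t) (f w *: dF + df *: F w).
Proof.
move=> [hf <-] [hF <-]; have hFij := (derivable_mxP _ _ _).1 hF.
have E i j : (fun t => (f t *: F t) i j) = f * (fun t => F t i j).
  by apply/funext => t; rewrite mxE.
have D : derivable (fun t => f t *: F t) w 1.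
  by apply/derivable_mxP => i j; rewrite E; exact: derivableM hf (hFij i j).
apply: (DeriveDef D); rewrite (derive_mx D) (derive_mx hF).
apply/matrixP => i j; rewrite mxE E (deriveM hf (hFij i j)) !mxE.
by congr (_ + _); rewrite [LHS]mulrC.
Qed.

Implicit Types P Q : 'M[R]_n.

(** Over [{poly R}], the determinant and adjugate of [P + t Q] are polynomials in [t], so their
    continuity and derivability come for free. *)
Definition pencil P Q : 'M[{poly R}]_n := map_mx polyC P + 'X *: map_mx polyC Q.

Lemma map_pencil P Q t : map_mx (horner_eval t) (pencil P Q) = P + t *: Q.
Proof. by apply/matrixP => i j; rewrite !mxE /horner_eval !hornerE. Qed.

Lemma pencil_unitmx_near P Q w : P + w *: Q \in unitmx ->
  \forall t \near w, P + t *: Q \in unitmx.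
Proof.
have E t : (P + t *: Q \in unitmx) = ((\det (pencil P Q)).[t] != 0).
  by rewrite unitmxE -map_pencil det_map_mx unitfE.
rewrite E => hw; near do rewrite E.
by apply: cvgr_neq0 hw; exact: continuous_horner.
Unshelve. all: by end_near. Qed.

Lemma derivable_invmx P Q w : P + w *: Q \in unitmx ->
  derivable (fun t : R => invmx (P + t *: Q)) w 1.
Proof.
move=> hw; apply/derivable_mxP => i j.
pose d := \det (pencil P Q); pose a := (\adj (pencil P Q)) i j.
(* By Cramer's rule, each entry of the inverse is a quotient of polynomials near [w]. *)
apply: (@near_eq_derivable R R R (fun t : R => d.[t]^-1 * a.[t])).
  near=> t.
  have ht : P + t *: Q \in unitmx by near: t; exact: pencil_unitmx_near.
  by rewrite /invmx ht mxE -map_pencil det_map_mx -map_mx_adj mxE.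
apply: derivableM; last exact: derivable_horner.
apply: derivableV; last exact: derivable_horner.
by move: hw; rewrite unitmxE -map_pencil det_map_mx unitfE.
Unshelve. all: by end_near. Qed.

(** The resolvent identity [G t = G w - (t - w) G t Q G w] holds near [w]. Differentiating it at [w]
    leaves only [- G w Q G w], because the derivative of [S] is multiplied by [w - w]. *)
Lemma is_derive_invmx P Q w : P + w *: Q \in unitmx ->
  let G t := invmx (P + t *: Q) in
  is_derive w 1 G (- (G w *m Q *m G w)).
Proof.
move=> hw G; have dG : derivable G w 1 by exact: derivable_invmx.
have GV : (P + w *: Q) *m G w = 1%:M by rewrite mulmxV.
have VG t : P + t *: Q \in unitmx -> G t *m (P + t *: Q) = 1%:M.
  by move=> ht; rewrite mulVmx.
clearbody G; have dS : derivable (fun t => G t *m (Q *m G w)) w 1.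
  by apply: (derivable_mulmx dG); exact: derivable_cst.
apply: (DeriveDef dG); rewrite (derive_mx dG).
apply/matrixP => i j; rewrite mxE.
pose S t := (G t *m (Q *m G w)) i j.
have dSij : derivable S w 1 by exact: ((derivable_mxP _ _ _).1 dS i j).
have -> : 'D_1 (fun t : R => G t i j) w =
    'D_1 (cst (G w i j) - (id - cst w) * S) w.
  apply: near_eq_derive; near=> t.
  have ht : P + t *: Q \in unitmx by near: t; exact: pencil_unitmx_near.
  have : G t = G w - (t - w) *: (G t *m (Q *m G w)).
    have -> : (t - w) *: (G t *m (Q *m G w)) =
        G t *m ((P + t *: Q) - (P + w *: Q)) *m G w.
      rewrite opprD addrACA subrr add0r -scalerBl.
      by rewrite -scalemxAr -scalemxAl mulmxA.
    rewrite mulmxBr VG // mulmxBl mul1mx -mulmxA GV mulmx1.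
    by rewrite opprB addrC subrK.
  by move=> ->; rewrite mxE [X in _ + X]mxE [X in _ - X]mxE.
have [_ ->] : is_derive w (1 : R) (cst (G w i j) - (id - cst w) * S)
    (0 - ((w - w) *: 'D_1 S w + S w *: (1 - 0))).
  by apply: is_deriveB; apply: is_deriveM; exact: derivableP.
by rewrite subrr scale0r !add0r subr0 [_ *: _]mulr1 /S mulmxA [RHS]mxE.
Unshelve. all: by end_near. Qed.

End InverseDerivative.

(** * The derivative of [H_SCI] on the unit interval *)

Section RateFunction.
Local Open Scope classical_set_scope.
Context {R : realType} {n : nat}.

Context (PA PB QA QB : 'M[R]_n) (x : 'cV[R]_n).
Context (hPA : spd PA) (hPB : spd PB) (hQA : spd QA) (hQB : spd QB).

(* Makes the [B] term an affine pencil in [w] as well. *)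
Lemma onem_pencil w : PB + (1 - w) *: QB = (PB + QB) + w *: (- QB).
Proof. by rewrite scalerBl scale1r scalerN addrA. Qed.

Lemma derive1_H_SCI w : 0 <= w <= 1 ->
  let A := invmx (PA + w *: QA) in
  let B := invmx (PB + (1 - w) *: QB) in
  derive1 (H_SCI PA PB QA QB) w =
  (A - w *: (A *m QA *m A)) - (B - (1 - w) *: (B *m QB *m B)).
Proof.
move=> /andP[w0 w1] A B; have w1' : 0 <= 1 - w by lra.
have HE : H_SCI PA PB QA QB = (fun t => t *: invmx (PA + t *: QA)) +
    (fun t => (1 - t) *: invmx (PB + QB + t *: - QB)).
  by apply/funext => t; rewrite /H_SCI onem_pencil.
have dA := is_derive_invmx (spd_unitmx (spdDZ hPA hQA w0)).
have := spd_unitmx (spdDZ hPB hQB w1').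
rewrite onem_pencil => /is_derive_invmx dB.
have d1 : is_derive w (1 : R) (fun t : R => 1 - t) (0 - 1).
  by apply: is_deriveB.
have dH := is_deriveD (is_derive_scale_mx (is_derive_id w 1) dA)
  (is_derive_scale_mx d1 dB).
rewrite derive1E HE (@derive_val _ _ _ _ _ _ _ dH) /= -onem_pencil -/A -/B.
rewrite sub0r scaleN1r scale1r mulmxN mulNmx opprK opprB scalerN.
by rewrite [- _ + A]addrC.
Qed.

Lemma qf_derive1_H_SCI w : 0 <= w <= 1 ->
  qf (derive1 (H_SCI PA PB QA QB) w) x =
  inv_rate PA QA x w - inv_rate PB QB x (1 - w).
Proof.
move=> hw; have /andP[w0 w1] := hw; rewrite derive1_H_SCI // qfE mulmxBl.
by rewrite dotDr dotNr !inv_rateE //; lra.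
Qed.

(** Provides the continuity required by the intermediate value theorem. *)
Lemma derivable_rate w : 0 <= w <= 1 ->
  derivable (fun t => inv_rate PA QA x t - inv_rate PB QB x (1 - t)) w 1.
Proof.
move=> /andP[w0 w1]; have w1' : 0 <= 1 - w by lra.
have D P (u : R -> 'cV[R]_n) :
    derivable u w 1 -> derivable (fun t => dot (u t) (P *m u t)) w 1.
  move=> du; apply: (derivable_mxP _ _ _).1; apply: derivable_mulmx.
    exact: derivable_trmx.
  by apply: derivable_mulmx => //; exact: derivable_cst.
apply: derivableB; apply: D.
  apply: derivable_mulmx; last exact: derivable_cst.
  exact/derivable_invmx/spd_unitmx/spdDZ.
apply: derivable_mulmx; last exact: derivable_cst.
have := spd_unitmx (spdDZ hPB hQB w1').
rewrite onem_pencil => /derivable_invmx.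
by under [X in _ -> derivable X _ _]eq_fun do rewrite onem_pencil.
Qed.

End RateFunction.

(** * The trichotomy and the values of [g] *)

Theorem theorem2 (R : realType) (n : nat) (hn : (0 < n)%N)
  (PA PB QA QB : 'M[R]_n)
  (hPA : spd PA) (hPB : spd PB) (hQA : spd QA) (hQB : spd QB)
  (x : 'cV[R]_n) (hx : x != 0) :
  let H := H_SCI PA PB QA QB in
  let H' := fun w : R => derive1 H w in
  let c1 := qf (H' 0) x < 0 in
  let c2 := 0 < qf (H' 1) x in
  let c3 := exists! w0 : R, (0 <= w0 <= 1) /\ qf (H' w0) x = 0 in
  (c1 \/ c2 \/ c3) /\
  ~ (c1 /\ c2) /\ ~ (c1 /\ c3) /\ ~ (c2 /\ c3) /\
  (c1 -> is_g_value PA PB QA QB x (qf (H 0) x)) /\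
  (c2 -> is_g_value PA PB QA QB x (qf (H 1) x)) /\
  (c3 -> forall w0 : R, 0 <= w0 <= 1 -> qf (H' w0) x = 0 ->
         is_g_value PA PB QA QB x (qf (H w0) x)).
Proof.
move=> H H' c1 c2 c3.
pose a := inv_rate PA QA x; pose b t := inv_rate PB QB x (1 - t).
have H'E w : 0 <= w <= 1 -> qf (H' w) x = a w - b w.
  by move=> hw; rewrite /H' qf_derive1_H_SCI.
have decr s t : 0 <= s -> s < t -> t <= 1 -> a t - b t < a s - b s.
  move=> s0 st t1; apply: ltrD; first exact: inv_rate_lt.
  by rewrite ltrN2; apply: inv_rate_lt => //; lra.
have i0 : 0 <= (0 : R) <= 1 by rewrite lexx ler01.
have i1 : 0 <= (1 : R) <= 1 by rewrite lexx ler01.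
have decr' s t : 0 <= s -> s <= t -> t <= 1 -> a t - b t <= a s - b s.
  by move=> s0; rewrite le_eqVlt => /predU1P[-> //|st] t1; exact/ltW/decr.
have gval w c : 0 <= w <= 1 -> a w <= c -> b w <= c -> w * (a w - c) = 0 ->
    (1 - w) * (b w - c) = 0 -> is_g_value PA PB QA QB x (qf (H w) x).
  move=> hw ac bc ea eb; have /andP[w0 _] := hw.
  have a0 : 0 < a w by exact: inv_rate_gt0.
  by apply: (@is_g_value_H_SCI R n PA PB QA QB w x c) => //; lra.
have zero_unique s t : 0 <= s <= 1 -> 0 <= t <= 1 ->
    a s - b s = 0 -> a t - b t = 0 -> s = t.
  move=> /andP[s0 s1] /andP[t0 t1] es et.
  by have [st|ts|//] := ltgtP s t; [have := decr s t|have := decr t s]; lra.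
have H'0 := H'E 0 i0; have H'1 := H'E 1 i1; clearbody H'.
rewrite /c1 /c2 H'0 H'1 {c1 c2}/c3.
split; [|split; [|split; [|split; [|split; [|split]]]]].
(* Outside the first two cases the derivative is nonnegative at 0 and nonpositive at 1, so it has a
   zero, unique by strict decrease. *)
- have [l0|g0] := ltP (a 0 - b 0) 0; first by left.
  have [l1|g1] := ltP 0 (a 1 - b 1); first by right; left.
  right; right; have [] := @IVT R (fun t => a t - b t) 0 1 0 ler01.
  + apply/continuous_in_subspaceT => t; rewrite inE /= in_itv /= => ht.
    apply/differentiable_continuous/derivable1_diffP.
    exact: derivable_rate.
  + by rewrite ge_min le_max g0 g1 orbT.
  move=> w; rewrite in_itv /= => hw ew; exists w; split.
    by rewrite (H'E w hw).
  by move=> t [ht]; rewrite (H'E t ht) => et; exact: zero_unique.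
- by case; have := decr' 0 1; lra.
- case=> l0 [w [[hw]]]; rewrite (H'E w hw) => ew _.
  by have /andP[w0 w1] := hw; have := decr' 0 w; lra.
- case=> l1 [w [[hw]]]; rewrite (H'E w hw) => ew _.
  by have /andP[w0 w1] := hw; have := decr' w 1; lra.
(* Here [c] is the larger rate: [b 0] at 0, then [a 1] at 1. The smaller one has weight zero. *)
- by move=> l0; apply: (gval 0 (b 0)) => //; lra.
- by move=> l1; apply: (gval 1 (a 1)) => //; lra.
- move=> _ w hw; rewrite (H'E w hw) => ew.
  by have /subr0_eq ab := ew; apply: (gval w (a w));
    rewrite // -?ab ?subrr ?mulr0.
Qed.
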